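(* Let $r\geq 2$ and let $G$ be a $K_{r+1}$-free graph with $n$ vertices and $m\geq 1$ edges. Then \[ \lambda_n(G)\geq \frac{2mn}{(r-1)(n^2-2m)}, \] with equality if and only if $G$ is a regular complete $r$-partite graph, i.e. a complete $r$-partite graph all of whose $r$ parts have size $n/r$.
   Context: All graphs are finite, simple and undirected. For a graph $G$ of order $n$, $A(G)$ is its adjacency matrix, $D(G)$ the diagonal matrix of its vertex degrees, and $L(G)=D(G)-A(G)$ its Laplacian; the eigenvalues of $L(G)$ are $0=\lambda_1(G)\leq\dots\leq\lambda_n(G)$, so $\lambda_n(G)$ is the largest Laplacian eigenvalue. $K_{r+1}$ denotes the complete graph on $r+1$ vertices; $G$ is $K_{r+1}$-free if it contains no subgraph isomorphic to $K_{r+1}$. *)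

(* Defs.v *)
From mathcomp Require Import all_boot all_order all_algebra.
Set Implicit Arguments. Unset Strict Implicit. Unset Printing Implicit Defensive.
Import Order.TTheory GRing.Theory Num.Theory.
Local Open Scope ring_scope.

Definition simple_graph (n : nat) (e : rel 'I_n) : Prop :=
  symmetric e /\ irreflexive e.

Definition deg (n : nat) (e : rel 'I_n) (i : 'I_n) : nat := #|[set j | e i j]|.

Definition num_edges (n : nat) (e : rel 'I_n) : nat :=
  #|[set p : 'I_n * 'I_n | ((p.1 < p.2)%N && e p.1 p.2)]|.

Definition adj_mx (R : rcfType) (n : nat) (e : rel 'I_n) : 'M[R]_n :=
  \matrix_(i, j) (e i j)%:R.
Definition deg_mx (R : rcfType) (n : nat) (e : rel 'I_n) : 'M[R]_n :=
  diag_mx (\row_i (deg e i)%:R).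
Definition lap_mx (R : rcfType) (n : nat) (e : rel 'I_n) : 'M[R]_n :=
  deg_mx R e - adj_mx R e.

Definition largest_eigenvalue (R : rcfType) (n : nat) (M : 'M[R]_n) (l : R) : Prop :=
  eigenvalue M l /\ (forall a, eigenvalue M a -> a <= l).

Definition clique (n : nat) (e : rel 'I_n) (S : {set 'I_n}) : Prop :=
  forall x y, x \in S -> y \in S -> x != y -> e x y.

Definition K_free (n : nat) (e : rel 'I_n) (k : nat) : Prop :=
  forall S : {set 'I_n}, #|S| = k -> ~ clique e S.

Definition regular_complete_multipartite (n : nat) (e : rel 'I_n) (r : nat) : Prop :=
  exists f : 'I_n -> 'I_r,
    (forall x y, e x y = (f x != f y)) /\
    (forall k : 'I_r, (#|[set x | f x == k]| * r)%N = n).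

(* Main.v *)
(** For each vertex u, apply the Rayleigh quotient bound to the indicator vector
    of the neighbourhood N(u), projected orthogonally to the constants; it reads
      l d(u) (n - d(u)) >= n (sum_(v in N(u)) d(v) - 2 e(N(u))).
    N(u) contains no K_r, so Turan's theorem bounds 2 e(N(u)) by
    (r-2)/(r-1) d(u)^2. Summing over u yields a bound in terms of sum d(u)^2, to
    which Cauchy-Schwarz applies.

    In the equality case G is regular and every projected indicator is an
    eigenvector for l. Its u-th coordinate gives l = n, and its v-th coordinate,
    for v not adjacent to u, then gives that u and v have the same neighbours:
    non-adjacency is an equivalence relation, with classes of size n - d = n/r.
    Conversely no Laplacian eigenvalue exceeds n, which is the value of the bound
    on a regular complete r-partite graph. *)
Require Import Defs.
From mathcomp Require Import all_boot all_order all_algebra.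
From mathcomp Require Import complex zify ring.
Import Order.TTheory GRing.Theory Num.Theory.
Local Open Scope ring_scope.
Set Implicit Arguments. Unset Strict Implicit. Unset Printing Implicit Defensive.

(** * Rayleigh quotients of real symmetric matrices *)

Lemma dotrE (R : comNzRingType) (n : nat) (x : 'rV[R]_n) :
  (x *m x^T) 0 0 = \sum_i x 0 i ^+ 2.
Proof. by rewrite mxE; apply: eq_bigr => i _; rewrite mxE. Qed.

Lemma dotr_gt0 (R : realDomainType) (n : nat) (x : 'rV[R]_n) :
  x != 0 -> 0 < (x *m x^T) 0 0.
Proof.
move=> x0; rewrite dotrE lt_neqAle sumr_ge0 ?andbT => [|i _]; last exact: sqr_ge0.
apply: contraNneq x0 => /esym/eqP; rewrite psumr_eq0 => [/allP xi0|i _]; last first.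
  exact: sqr_ge0.
apply/eqP/rowP => i; have := xi0 i (mem_index_enum i).
by rewrite expf_eq0 mxE => /eqP.
Qed.

(** A unitary diagonalisation over [complex R] turns the form into a sum of real eigenvalues
    weighted by the squared moduli [w x i] of the coordinates. The largest eigenvalue bounds it, and
    equality kills every coordinate that belongs to a smaller one. *)
Lemma rayleigh_symmetric (R : rcfType) (n : nat) (M : 'M[R]_n) :
  (0 < n)%N -> M^T = M ->
  exists l, [/\ largest_eigenvalue M l,
    forall x : 'rV_n, (x *m M *m x^T) 0 0 <= l * (x *m x^T) 0 0 &
    forall x : 'rV_n,
      (x *m M *m x^T) 0 0 = l * (x *m x^T) 0 0 -> x *m M = l *: x].
Proof.
case: n M => // n M _ Msym; pose toC : {rmorphism R -> complex R} := real_complex R; pose A := map_mx toC M.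
have Areal : A \is a mxOver Num.real.
  by apply/mxOverP => i j; rewrite mxE; apply/complex_realP; exists (M i j).
have Aherm : A \is hermsymmx.
  apply: realsym_hermsym => //; apply/is_hermitianmxP.
  rewrite expr0 scale1r map_mx_id //.
  by rewrite [RHS]map_trmx Msym.
have /orthomx_spectralP := hermitian_normalmx Aherm.
have := hermitian_spectral_diag_real Aherm.
have := spectral_unitarymx A.
move: (spectralmx A) (spectral_diag A) => P d Pu dreal.
rewrite invmx_unitary //; set Q := map_mx _ _ => AE.
have PQ : P *m Q = 1%:M by apply/unitarymxP.
have QP : Q *m P = 1%:M by apply: mulmx1C.
pose D i := complex.Re (d 0 i).
have dD i : d 0 i = toC (D i) by rewrite [RHS]RRe_real // (mxOverP dreal).
pose k := [arg max_(i > (ord0 : 'I_n.+1)) D i]%O.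
have kmax i : D i <= D k by rewrite /k; case: arg_maxP => // j _ /(_ i isT).
(* Row [k] of [P] is a complex eigenvector; whether [D k] is an eigenvalue can be tested over either
   field. *)
have Deig : eigenvalue M (D k).
  rewrite -(eigenvalue_map toC); apply/eigenvalueP; exists (row k P).
    rewrite -[map_mx _ M]/A AE -row_mul !mulmxA PQ mul1mx.
    by apply/rowP => j; rewrite mxE mul_diag_mx !mxE dD.
  apply/negP => /eqP rk0; have /matrixP/(_ k k) := PQ.
  rewrite !mxE eqxx big1 => [/esym/eqP|i _]; first by rewrite oner_eq0.
  by have /rowP/(_ i) := rk0; rewrite !mxE => ->; rewrite mul0r.
pose X (x : 'rV[R]_n.+1) := map_mx toC x.
pose y x := X x *m Q.
pose w x i := complex.Re (y x 0 i) ^+ 2 + complex.Im (y x 0 i) ^+ 2.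
have wE x i : y x 0 i * Num.conj (y x 0 i) = toC (w x i).
  by rewrite -normCK -add_Re2_Im2.
have yT x : map_mx Num.conj (y x)^T = P *m map_mx toC x^T.
  rewrite trmx_mul map_mxM; congr (_ *m _).
    apply/matrixP => i j; rewrite !mxE. exact: conjCK.
  by apply/matrixP => i j; rewrite !mxE; apply: conj_Creal; apply/complex_realP; eexists.
have sumE x (c : 'I_n.+1 -> R) :
    (y x *m diag_mx (\row_i toC (c i)) *m map_mx Num.conj (y x)^T) 0 0 =
    toC (\sum_i c i * w x i).
  rewrite mul_mx_diag mxE rmorph_sum; apply: eq_bigr => i _.
  by rewrite rmorphM -wE !mxE; ring.
have normE (x : 'rV_n.+1) : (x *m x^T) 0 0 = \sum_i 1 * w x i.
  apply: (@complexI R); rewrite -[RHS]sumE.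
  have -> : diag_mx (\row_(i < n.+1) toC 1) = 1%:M.
    by apply/matrixP => i j; rewrite !mxE rmorph1.
  rewrite mulmx1 yT mulmxA -(mulmxA (X x)) QP mulmx1 -map_mxM.
  by rewrite [RHS]mxE.
have dE : d = \row_i toC (D i) by apply/rowP => i; rewrite mxE dD.
have quadE (x : 'rV_n.+1) : (x *m M *m x^T) 0 0 = \sum_i D i * w x i.
  apply: (@complexI R); rewrite -[RHS]sumE -dE yT.
  by rewrite /y -!mulmxA (mulmxA Q) (mulmxA (Q *m _)) -AE -!map_mxM mulmxA [RHS]mxE.
have w_ge0 x i : 0 <= w x i by rewrite addr_ge0 ?sqr_ge0.
have le_quad (x : 'rV_n.+1) : (x *m M *m x^T) 0 0 <= D k * (x *m x^T) 0 0.
  rewrite quadE normE mulr_sumr; apply: ler_sum => i _.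
  by rewrite mul1r ler_wpM2r.
exists (D k); split => //.
  split=> // a /eigenvalueP[x xM x0].
  by have := le_quad x; rewrite xM -scalemxAl mxE ler_pM2r // dotr_gt0.
move=> x /eqP. rewrite quadE normE mulr_sumr -subr_eq0 -oppr_eq0 opprB -sumrB.
(* Each [(D k - D i) * w x i] vanishes, so coordinate [i] is zero unless [D i = D k]. *)
rewrite psumr_eq0 => [/allP w0|i _]; last by rewrite mul1r subr_ge0 ler_wpM2r.
apply: (@map_mx_inj _ _ toC).
rewrite map_mxM -[map_mx _ M]/A map_mxZ.
have -> : map_mx toC x *m A = y x *m diag_mx d *m P by rewrite AE !mulmxA.
have -> : toC (D k) *: map_mx toC x = (toC (D k) *: y x) *m P.
  by rewrite -scalemxAl -mulmxA QP mulmx1.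
congr (_ *m _); apply/rowP => i; rewrite mul_mx_diag [LHS]mxE [RHS]mxE dD.
have /eqP := w0 i (mem_index_enum i).
rewrite mul1r -mulrBl => /eqP; rewrite mulf_eq0 => /orP[|].
  by rewrite subr_eq0 => /eqP ->; rewrite mulrC.
move=> /eqP w0i; suff /eqP -> : y x 0 i == 0 by rewrite mulr0 mul0r.
by rewrite -normr_eq0 -sqrf_eq0 -add_Re2_Im2 -/(w x i) w0i.
Qed.

(** * Turan's theorem, counting arcs *)

(* Ordered pairs: this is twice the number of edges inside S. *)
Definition arcs_within (n : nat) (e : rel 'I_n) (S : {set 'I_n}) : nat :=
  (\sum_(i in S) \sum_(j in S) e i j)%N.

(* Induction on s through the neighbourhood N, inside S, of a vertex of maximal
   degree: every arc not inside N has an endpoint in S :\: N. *)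
Lemma turan (n s : nat) (e : rel 'I_n) (S : {set 'I_n}) :
  simple_graph e ->
  (forall T : {set 'I_n}, T \subset S -> #|T| = s.+2 -> ~ clique e T) ->
  (s.+1 * arcs_within e S <= s * #|S| ^ 2)%N.
Proof.
case=> esym eirr; elim: s S => [|s IHs] S noclique.
  rewrite mul1n mul0n leqn0 /arcs_within; apply/eqP.
  apply: big1 => i iS; apply: big1 => j jS; case: (boolP (e i j)) => // eij.
  have ij : i != j by apply: contraTneq eij => ->; rewrite eirr.
  case: (noclique [set i; j]); rewrite ?cards2 ?ij //.
    by apply/subsetP => k; rewrite !inE => /orP[] /eqP ->.
  by move=> x y; rewrite !inE => /orP[] /eqP -> /orP[] /eqP ->;
    rewrite ?eqxx // esym.
have [->|/set0Pn[v0 v0S]] := eqVneq S set0.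
  by rewrite /arcs_within big_set0 muln0.
pose dS i := (\sum_(j in S) e i j)%N.
pose v := [arg max_(i > v0 in S) dS i].
have [vS vmax] : v \in S /\ forall i, i \in S -> (dS i <= dS v)%N.
  by rewrite /v; case: arg_maxnP.
pose N := [set j in S | e v j].
have NS : N \subset S by apply/subsetP => j; rewrite inE => /andP[].
have dSv : dS v = #|N|.
  rewrite /dS -sum1_card big_mkcond [RHS]big_mkcond; apply: eq_bigr => j _.
  by rewrite inE; case: (j \in S); case: (e v j).
have IHN : (s.+1 * arcs_within e N <= s * #|N| ^ 2)%N.
  apply: IHs => T TN cardT cliqueT.
  have vT : v \notin T by apply/negP => /(subsetP TN); rewrite inE eirr andbF.
  apply: (noclique (v |: T)).
  - by rewrite subUset sub1set vS (subset_trans TN).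
  - by rewrite cardsU1 vT cardT.
  have evT x : x \in T -> e v x by move=> /(subsetP TN); rewrite inE => /andP[].
  move=> x y; rewrite !inE => /predU1P[->|xT] /predU1P[->|yT].
  - by rewrite eqxx.
  - by move=> _; apply: evT.
  - by move=> _; rewrite esym; apply: evT.
  exact: cliqueT.
have SIN : S :&: N = N by apply/setIidPr.
have outside : (\sum_(i in S :\: N) dS i <= #|S :\: N| * #|N|)%N.
  rewrite -sum_nat_const; apply: leq_sum => i; rewrite inE => /andP[_ iS].
  by rewrite -dSv vmax.
have split : (arcs_within e S <= arcs_within e N + 2 * (#|S :\: N| * #|N|))%N.
  rewrite /arcs_within (big_setID N) SIN /= mulSn mul1n addnA leq_add //.
  under eq_bigr do rewrite (big_setID N) SIN /=.
  rewrite big_split leq_add2l exchange_big /=; apply: leq_trans outside.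
  apply: leq_sum => j _; rewrite /dS [leqRHS](big_setID N) SIN /=.
  by apply: leq_trans (leq_addr _ _); apply: leq_sum => i _; rewrite esym.
have := cardsID N S; rewrite SIN => cardS.
rewrite -cardS; move: (#|N|) (#|S :\: N|) (arcs_within e N) (arcs_within e S) IHN split.
move=> d k EN ES IHN split; rewrite -(leq_pmul2l (ltn0Sn s)).
have := leq_mul (leqnn s.+2) IHN.
have := leq_mul (leqnn (s.+1 * s.+2)) split.
(* Once multiplied by s+1, the claim has room for exactly the square of (s+1)k - d. *)
have [cauchy _] := nat_Cauchy (s.+1 * k) d; move: cauchy.
nia.
Qed.

(** * Degree sum and Laplacian quadratic form *)

Lemma handshake (n : nat) (e : rel 'I_n) :
  simple_graph e -> (2 * num_edges e = \sum_i deg e i)%N.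
Proof.
case=> esym eirr.
have -> : (\sum_i deg e i = \sum_(p : 'I_n * 'I_n) e p.1 p.2)%N.
  rewrite -(pair_bigA _ (fun i j => e i j : nat)); apply: eq_bigr => i _.
  by rewrite /deg -sum1_card big_mkcond; apply: eq_bigr => j _; rewrite inE; case: (e i j).
have -> : (num_edges e = \sum_(p : 'I_n * 'I_n) (p.1 < p.2)%N && e p.1 p.2)%N.
  rewrite /num_edges -sum1_card big_mkcond; apply: eq_bigr => p _.
  by rewrite inE; case: (_ && _).
rewrite mulSn mul1n.
(* Swapping the entries of the pairs in one copy counts each edge once in either direction. *)
rewrite [X in (X + _)%N](reindex_inj (inv_inj (_ : involutive (fun p : 'I_n * 'I_n => (p.2, p.1))))); last by case.
rewrite -big_split; apply: eq_bigr => -[i j] _ /=; rewrite (esym j).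
case: ltngtP => [_|_|/ord_inj ->]; rewrite ?addn0 //.
by rewrite eirr.
Qed.

Section Laplacian.
Variables (R : rcfType) (n : nat) (e : rel 'I_n).
Hypothesis graph_e : simple_graph e.

Lemma natr_deg (i : 'I_n) : (deg e i)%:R = \sum_j (e i j)%:R :> R.
Proof.
rewrite /deg -sum1_card natr_sum big_mkcond; apply: eq_bigr => j _.
by rewrite inE; case: (e i j).
Qed.

Lemma lap_mx_sym : (lap_mx R e)^T = lap_mx R e.
Proof.
case: graph_e => esym _; rewrite linearB /= tr_diag_mx; congr (_ - _).
by apply/matrixP => i j; rewrite !mxE esym.
Qed.

Lemma mulmx_lap (x : 'rV[R]_n) (v : 'I_n) :
  (x *m lap_mx R e) 0 v = \sum_j (e v j)%:R * (x 0 v - x 0 j).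
Proof.
case: graph_e => esym _.
rewrite mulmxBr mul_mx_diag !mxE natr_deg mulr_sumr -sumrB.
by apply: eq_bigr => j _; rewrite !mxE esym; ring.
Qed.

Lemma lap_form (x : 'rV[R]_n) :
  2 * (x *m lap_mx R e *m x^T) 0 0 =
  \sum_i \sum_j (e i j)%:R * (x 0 i - x 0 j) ^+ 2.
Proof.
case: graph_e => esym _.
have E : (x *m lap_mx R e *m x^T) 0 0 =
    \sum_i \sum_j (e i j)%:R * (x 0 i - x 0 j) * x 0 i.
  rewrite mxE; apply: eq_bigr => i _; rewrite mulmx_lap mxE mulr_suml.
  by apply: eq_bigr => j _.
rewrite mulr_natl mulr2n {1}E E [X in X + _]exchange_big -big_split; apply: eq_bigr => i _.
by rewrite -big_split; apply: eq_bigr => j _; rewrite /= esym; ring.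
Qed.

(** Adding the missing edges can only increase the form, and for the complete graph it is n times
    the squared norm minus the square of the coordinate sum. *)
Lemma lap_form_le (x : 'rV[R]_n) :
  (x *m lap_mx R e *m x^T) 0 0 <= n%:R * (x *m x^T) 0 0.
Proof.
rewrite -(ler_pM2l (_ : 0 < 2 :> R)) ?ltr0n // lap_form dotrE.
apply: (@le_trans _ _ (\sum_i \sum_j (x 0 i - x 0 j) ^+ 2)).
  apply: ler_sum => i _; apply: ler_sum => j _.
  by case: (e i j); rewrite ?mul1r ?mul0r ?sqr_ge0.
have -> : \sum_i \sum_j (x 0 i - x 0 j) ^+ 2 =
    2 * (n%:R * \sum_i x 0 i ^+ 2) - 2 * (\sum_i x 0 i) ^+ 2.
  rewrite [in RHS]expr2 mulr_suml.
  under [X in _ - 2 * X]eq_bigr do rewrite mulr_sumr.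
  have sumc (F : 'I_n -> R) : n%:R * \sum_i F i = \sum_i \sum_(j < n) F i.
    by rewrite mulr_sumr; apply: eq_bigr => i _; rewrite sumr_const card_ord mulr_natl.
  rewrite [X in X - _]mulr_natl mulr2n {1}sumc sumc [X in _ + X - _]exchange_big /=.
  rewrite -big_split mulr_sumr -sumrB; apply: eq_bigr => i _.
  rewrite -big_split mulr_sumr -sumrB; apply: eq_bigr => j _ /=; ring.
by rewrite gerBl mulr_ge0 ?sqr_ge0.
Qed.

(** The indicator vector of [S], projected orthogonally to the constants. *)
Definition cut_vector (S : {set 'I_n}) : 'rV[R]_n :=
  \row_i ((i \in S)%:R - #|S|%:R / n%:R).

Lemma dotr_cut_vector (S : {set 'I_n}) :
  (0 < n)%N ->
  n%:R * (cut_vector S *m (cut_vector S)^T) 0 0 = #|S|%:R * (n%:R - #|S|%:R).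
Proof.
move=> n_gt0; have n0 : n%:R != 0 :> R by rewrite pnatr_eq0 -lt0n.
rewrite dotrE; pose c : R := #|S|%:R / n%:R.
have -> : \sum_i cut_vector S 0 i ^+ 2 =
    \sum_(i < n) ((i \in S)%:R * (1 - 2 * c) + c ^+ 2).
  by apply: eq_bigr => i _; rewrite mxE -/c; case: (i \in S) => /=; ring.
rewrite big_split /= sumr_const card_ord -mulr_suml -mulr_natl.
have -> : \sum_i (i \in S)%:R = #|S|%:R :> R.
  by rewrite -sum1_card natr_sum [RHS]big_mkcond; apply: eq_bigr => i _; case: (i \in S).
by rewrite /c; field.
Qed.

(** The form sees only differences of coordinates, so the shift by the mean drops out and the edges
    leaving [S] are counted. *)
Lemma lap_form_cut_vector (S : {set 'I_n}) :
  (cut_vector S *m lap_mx R e *m (cut_vector S)^T) 0 0 =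
  \sum_(i in S) (deg e i)%:R - (arcs_within e S)%:R.
Proof.
case: graph_e => esym _.
apply: (mulfI (_ : 2 != 0 :> R)); first by rewrite pnatr_eq0.
rewrite lap_form.
have -> : \sum_i \sum_j (e i j)%:R * (cut_vector S 0 i - cut_vector S 0 j) ^+ 2
  = \sum_i \sum_j ((e i j)%:R * (i \in S)%:R + (e j i)%:R * (j \in S)%:R
     - 2 * ((i \in S)%:R * ((j \in S)%:R * (e i j)%:R))) :> R.
  apply: eq_bigr => i _; apply: eq_bigr => j _; rewrite !mxE (esym j).
  by case: (i \in S); case: (j \in S) => /=; ring.
under eq_bigr do rewrite sumrB big_split.
rewrite sumrB big_split /= [X in _ + X - _]exchange_big /=.
rewrite mulrBr [in RHS]mulr_natl mulr2n; congr (_ + _ - _).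
- rewrite [RHS]big_mkcond; apply: eq_bigr => i _; rewrite natr_deg -mulr_suml.
  by case: (i \in S); rewrite ?mulr1 ?mulr0.
- rewrite [RHS]big_mkcond; apply: eq_bigr => i _; rewrite natr_deg -mulr_suml.
  by case: (i \in S); rewrite ?mulr1 ?mulr0.
rewrite /arcs_within natr_sum mulr_sumr [in RHS]big_mkcond; apply: eq_bigr => i _.
rewrite -mulr_sumr -mulr_sumr; case: (i \in S); rewrite ?mul0r ?mulr0 // mul1r.
congr (_ * _); rewrite natr_sum [RHS]big_mkcond; apply: eq_bigr => j _.
by case: (j \in S); rewrite ?mul1r ?mul0r.
Qed.

End Laplacian.

(** * Multipartite structure and degree counts *)

(** Non-adjacency is an equivalence relation with classes [C x]; a vertex is coloured by the index
    of its class in an enumeration of the classes. *)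
Lemma regular_complete_multipartiteI (n r c : nat) (e : rel 'I_n) :
  simple_graph e -> (0 < c)%N -> (c * r = n)%N ->
  (forall x, #|[set y | ~~ e x y]| = c) ->
  (forall x y z, ~~ e x y -> e x z = e y z) ->
  regular_complete_multipartite e r.
Proof.
move=> [esym eirr] c_gt0 crn cardC twin.
pose C x := [set y | ~~ e x y].
have CE x y : (C x == C y) = ~~ e x y.
  apply/eqP/idP => [/setP/(_ y)|nxy]; first by rewrite !inE eirr.
  by apply/setP => z; rewrite !inE (twin _ _ z nxy).
pose P := [set C x | x : 'I_n].
have memP x : C x \in enum P by rewrite mem_enum imset_f.
(* The classes partition the n = c r vertices into sets of size c. *)
have cardP : #|P| = r.
  apply/eqP; rewrite -(eqn_pmul2r c_gt0) (mulnC r) crn -sum_nat_const; apply/eqP.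
  rewrite -[RHS]card_ord -[RHS]sum1_card [RHS](partition_big_imset C) /=.
  apply: eq_bigr => B /imsetP[x _ ->]; rewrite -(cardC x) -sum1_card.
  by apply: eq_bigl => y; rewrite CE inE esym.
have f_subproof x : (index (C x) (enum P) < r)%N.
  by rewrite -cardP cardE index_mem.
exists (fun x => Ordinal (f_subproof x)); split=> [x y|[i /= ir]].
  apply/negb_inj; rewrite negbK -CE.
  apply/eqP/eqP => [eqC|[eqC]]; first by apply: val_inj; rewrite /= eqC.
  by rewrite -(nth_index set0 (memP x)) eqC nth_index.
have : nth set0 (enum P) i \in enum P by rewrite mem_nth // -cardE cardP.
rewrite mem_enum => /imsetP[y _ iE].
rewrite -[RHS]crn -(cardC y); congr (#|pred_of_set _| * _)%N; apply/setP => x.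
rewrite !inE esym -CE; apply/eqP/eqP => [[xi]|eqC]; first by rewrite -iE -xi nth_index.
apply: val_inj; rewrite /= eqC.
by rewrite -iE index_uniq ?enum_uniq // -cardE cardP.
Qed.

(** Double counting: the degree of v is added once for each neighbour of v. *)
Lemma deg_sum_sq (R : rcfType) (n : nat) (e : rel 'I_n) :
  simple_graph e ->
  \sum_u \sum_(v in [set j | e u j]) (deg e v)%:R
  = \sum_u (deg e u)%:R ^+ 2 :> R.
Proof.
case=> esym _; under eq_bigr do rewrite big_mkcond.
rewrite exchange_big; apply: eq_bigr => v _ /=.
rewrite expr2 {3}natr_deg mulr_sumr; apply: eq_bigr => u _.
by rewrite inE esym; case: (e v u); rewrite ?mulr1 ?mulr0.
Qed.

Lemma lap_form_ge0 (R : rcfType) (n : nat) (e : rel 'I_n) (x : 'rV[R]_n) :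
  simple_graph e -> 0 <= (x *m lap_mx R e *m x^T) 0 0.
Proof.
move=> graph_e; rewrite -(pmulr_rge0 _ (_ : 0 < 2 :> R)) ?ltr0n // lap_form //.
by apply: sumr_ge0 => i _; apply: sumr_ge0 => j _; rewrite mulr_ge0 ?ler0n ?sqr_ge0.
Qed.

(** The non-neighbours of a vertex form its own part, and c r = n fixes the size of every part. *)
Lemma regular_multipartite_deg (n r : nat) (e : rel 'I_n) :
  (0 < n)%N -> regular_complete_multipartite e r ->
  exists c, [/\ (0 < c)%N, (c * r = n)%N & forall x, (deg e x + c = n)%N].
Proof.
move=> n_gt0 [f [eE fibre]]; pose c (x : 'I_n) := #|[set y | f y == f x]|.
have [x0 _] : exists x0 : 'I_n, true by exists (Ordinal n_gt0).
have cr x : (c x * r = n)%N by apply: fibre.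
have r_gt0 : (0 < r)%N.
  by rewrite lt0n; apply: contraTneq (n_gt0) => r0; rewrite -(cr x0) r0 muln0.
exists (c x0); split=> [||x]; rewrite ?cr //.
  by rewrite lt0n; apply: contraTneq (n_gt0) => c0; rewrite -(cr x0) c0.
have -> : c x0 = c x by apply/eqP; rewrite -(eqn_pmul2r r_gt0) !cr.
rewrite -[RHS]card_ord -(cardsC [set j | e x j]); congr (_ + _)%N.
by apply: eq_card => y; rewrite !inE eE negbK eq_sym.
Qed.

(** * The defects in the inequalities, with [k] standing for r - 2 *)

Section Bound.
Variables (R : rcfType) (n k : nat) (e : rel 'I_n) (l : R).
Hypotheses (graph_e : simple_graph e) (K_free_e : K_free e k.+3).
Hypothesis n_gt0 : (0 < n)%N.
Hypothesis rayleigh :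
  forall x : 'rV[R]_n, (x *m lap_mx R e *m x^T) 0 0 <= l * (x *m x^T) 0 0.

Let N u := [set j | e u j].
Let d u : R := (deg e u)%:R.
Let T := \sum_u d u.

(** Defect of the Rayleigh bound at the cut vector of [N u], times n to clear denominators. *)
Definition rayleigh_slack u : R :=
  l * (d u * (n%:R - d u)) - n%:R * (\sum_(v in N u) d v - (arcs_within e (N u))%:R).

(** Defect of Turan's bound inside [N u]. *)
Definition turan_slack u : R :=
  k%:R * d u ^+ 2 - k.+1%:R * (arcs_within e (N u))%:R.

Lemma rayleigh_slackE u :
  rayleigh_slack u = n%:R * (l * (cut_vector R (N u) *m (cut_vector R (N u))^T) 0 0
    - (cut_vector R (N u) *m lap_mx R e *m (cut_vector R (N u))^T) 0 0).
Proof.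
by rewrite lap_form_cut_vector // mulrBr mulrCA dotr_cut_vector.
Qed.

Lemma rayleigh_slack_ge0 u : 0 <= rayleigh_slack u.
Proof. by rewrite rayleigh_slackE mulr_ge0 // subr_ge0. Qed.

(** A clique on k+2 vertices in [N u] would extend by [u] to one on k+3 vertices. *)
Lemma turan_slack_ge0 u : 0 <= turan_slack u.
Proof.
rewrite /turan_slack subr_ge0 -natrX -!natrM ler_nat; apply: turan => // S SN cardS cliqueS.
case: (graph_e) => esym eirr.
have uS : u \notin S by apply/negP => /(subsetP SN); rewrite inE eirr.
have euS x : x \in S -> e u x by move=> /(subsetP SN); rewrite inE.
apply: (K_free_e (S := u |: S)); first by rewrite cardsU1 uS cardS.
move=> x y; rewrite !inE => /predU1P[->|xS] /predU1P[->|yS].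
- by rewrite eqxx.
- by move=> _; apply: euS.
- by move=> _; rewrite esym; apply: euS.
exact: cliqueS.
Qed.

(* The remaining sum on the left is the Cauchy-Schwarz defect of the degrees, so
   the left-hand side is a nonnegative combination of the three defects. *)
Lemma slack_identity :
  n%:R ^+ 2 * \sum_u (k.+1%:R * rayleigh_slack u + n%:R * turan_slack u)
  + (k.+1%:R * l + n%:R) * \sum_u (n%:R * d u - T) ^+ 2
  = n%:R * T * (k.+1%:R * l * (n%:R ^+ 2 - T) - n%:R * T).
Proof.
set S2 := \sum_u d u ^+ 2.
have -> : \sum_u (n%:R * d u - T) ^+ 2 = n%:R ^+ 2 * S2 - n%:R * T ^+ 2.
  have -> : \sum_u (n%:R * d u - T) ^+ 2 =
      \sum_(u < n) (n%:R ^+ 2 * d u ^+ 2 + (- (2 * n%:R * T) * d u + T ^+ 2)).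
    by apply: eq_bigr => u _; ring.
  rewrite !big_split /= -!mulr_sumr sumr_const card_ord -mulr_natl -/T -/S2; ring.
(* The weights k+1 and n are chosen so that the [arcs_within] terms cancel. *)
have -> : \sum_u (k.+1%:R * rayleigh_slack u + n%:R * turan_slack u) =
    k.+1%:R * l * (n%:R * T - S2) - n%:R * S2.
  have -> : \sum_u (k.+1%:R * rayleigh_slack u + n%:R * turan_slack u) =
      \sum_u (k.+1%:R * l * n%:R * d u +
       ((n%:R * k%:R - k.+1%:R * l) * d u ^+ 2
       - k.+1%:R * n%:R * \sum_(v in N u) d v)).
    by apply: eq_bigr => u _; rewrite /rayleigh_slack /turan_slack; ring.
  rewrite !big_split /= sumrN -!mulr_sumr deg_sum_sq // -/T -/S2 -[k.+1]addn1 natrD.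
  ring.
(* The weight of the Cauchy-Schwarz defect makes [S2] cancel as well. *)
ring.
Qed.

(** Zero slack makes the cut vector of [N u] an eigenvector. At its coordinate [v] the means cancel
    in the Laplacian, leaving minus the number of common neighbours of [u] and [v]. *)
Lemma cut_eigenvector_codegree :
  (forall x : 'rV[R]_n, (x *m lap_mx R e *m x^T) 0 0 = l * (x *m x^T) 0 0 ->
     x *m lap_mx R e = l *: x) ->
  forall u v, rayleigh_slack u = 0 -> ~~ e u v ->
  n%:R * \sum_(j in N u) (e v j)%:R = l * d u.
Proof.
move=> eigen u v /eqP; have n0 : n%:R != 0 :> R by rewrite pnatr_eq0 -lt0n.
rewrite rayleigh_slackE mulf_eq0 (negPf n0) subr_eq0 => /eqP/esym/eigen/rowP/(_ v).
move=> + euv; rewrite mulmx_lap // [RHS]mxE.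
have -> : cut_vector R (N u) 0 v = - (d u / n%:R).
  by rewrite mxE inE (negPf euv) sub0r.
have -> : \sum_j (e v j)%:R * (- (d u / n%:R) - cut_vector R (N u) 0 j) =
    - \sum_(j in N u) (e v j)%:R.
  rewrite -sumrN [RHS]big_mkcond; apply: eq_bigr => j _; rewrite mxE.
  by case: (j \in N u) => /=; rewrite -/(deg e u) /d; ring.
by rewrite mulrN => /oppr_inj ->; field.
Qed.

End Bound.

(** * The bound and its equality case *)

Theorem theorem1 (R : rcfType) (n r : nat) (e : rel 'I_n) :
  simple_graph e -> (2 <= r)%N -> K_free e r.+1 -> (1 <= num_edges e)%N ->
  exists l : R, largest_eigenvalue (lap_mx R e) l /\
    let m := (num_edges e)%:R : R in
    let bound := (2 * m * n%:R) / ((r%:R - 1) * (n%:R ^+ 2 - 2 * m)) in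
    bound <= l /\ (l = bound <-> regular_complete_multipartite e r).
Proof.
case: r => [|[|k]] // graph_e _ Kfree m_gt0; case: (graph_e) => esym eirr.
have n_gt0 : (0 < n)%N.
  move: m_gt0; rewrite card_gt0 => /set0Pn[[i j] _]; exact: leq_ltn_trans (ltn_ord i).
have [l [lmax rayleigh eigen]] := rayleigh_symmetric n_gt0 (lap_mx_sym R graph_e).
exists l; split=> // m.
pose d u : R := (deg e u)%:R; pose T := \sum_u d u.
have TE : 2 * m = T by rewrite /m -natrM handshake // natr_sum.
have T_gt0 : 0 < T by rewrite -TE mulr_gt0 ?ltr0n.
have nR : 0 < n%:R :> R by rewrite ltr0n.
have deg_lt u : (deg e u < n)%N.
  rewrite -[X in (_ < X)%N]card_ord -cardsT; apply: proper_card.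
  by apply/properP; split; [apply: subsetT|exists u; rewrite ?inE ?eirr].
have T_lt : T < n%:R ^+ 2.
  rewrite expr2 mulr_natl -[X in _ *+ X]card_ord -sumr_const.
  apply: ltr_sum => [|u _]; last by rewrite ltr_nat.
  by apply/hasP; exists (Ordinal n_gt0); rewrite ?mem_index_enum.
have k1E : k.+2%:R - 1 = k.+1%:R :> R by rewrite -natr1 addrK.
have kR : 0 < k.+1%:R :> R by rewrite ltr0n.
rewrite k1E TE => bound.
have den_gt0 : 0 < k.+1%:R * (n%:R ^+ 2 - T) by rewrite mulr_gt0 ?subr_gt0.
have l_ge0 : 0 <= l.
  case: lmax => /eigenvalueP[x xL x0] _; have := lap_form_ge0 x graph_e.
  by rewrite xL -scalemxAl mxE pmulr_lge0 // dotr_gt0.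
have kln_gt0 : 0 < k.+1%:R * l + n%:R by rewrite ltr_wpDl // mulr_ge0 // ltW.
have ident := slack_identity k l graph_e; rewrite -/d -/T in ident.
have slack_ge0 u : 0 <= k.+1%:R * rayleigh_slack e l u + n%:R * turan_slack R k e u.
  by rewrite addr_ge0 ?mulr_ge0 ?ler0n ?rayleigh_slack_ge0 ?turan_slack_ge0.
(* The numerator is the last factor in [slack_identity], so its sign can be read off there. *)
have boundE : l - bound =
   (k.+1%:R * l * (n%:R ^+ 2 - T) - n%:R * T) / (k.+1%:R * (n%:R ^+ 2 - T)).
  rewrite /bound; field.
  by rewrite nat1r subr_eq0 !gt_eqF.
have bound_le : bound <= l.
  rewrite -subr_ge0 boundE divr_ge0 //; last exact: ltW.
  rewrite -(pmulr_rge0 _ (mulr_gt0 nR T_gt0)) -ident.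
  rewrite addr_ge0 ?mulr_ge0 ?sqr_ge0 ?sumr_ge0 // ?ltW // => u _; exact: sqr_ge0.
split=> //; split=> [lb|multi]; last first.
  apply/eqP; rewrite eq_le bound_le andbT.
  have [c [c_gt0 crn degE]] := regular_multipartite_deg n_gt0 multi.
  have cR : 0 < c%:R :> R by rewrite ltr0n.
  have nE : n%:R = c%:R * (k.+1%:R + 1) :> R by rewrite natr1 -natrM crn.
  have TcE : T = n%:R * (n%:R - c%:R).
    rewrite /T (eq_bigr (fun _ => n%:R - c%:R)) => [|u _].
      by rewrite sumr_const card_ord mulr_natl.
    by rewrite -[X in X%:R - _](degE u) natrD addrK.
  (* It then remains to see that no eigenvalue exceeds n, which is [lap_form_le]. *)
  have -> : bound = n%:R.
    rewrite /bound; have -> : n%:R ^+ 2 - T = n%:R * c%:R by rewrite TcE; ring.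
    rewrite TcE [X in _ * (X - _)]nE; field.
    by rewrite nat1r !gt_eqF.
  case: lmax => /eigenvalueP[x xL x0] _; have := lap_form_le graph_e x.
  by rewrite xL -scalemxAl mxE ler_pM2r // dotr_gt0.
have num0 : k.+1%:R * l * (n%:R ^+ 2 - T) - n%:R * T = 0.
  move/eqP: boundE; rewrite lb subrr eq_sym mulf_eq0 invr_eq0 (gt_eqF den_gt0) orbF.
  by rewrite -lb => /eqP.
(* A vanishing sum of nonnegative defects: all degrees agree and every slack is zero. *)
move/eqP: ident; rewrite num0 mulr0 paddr_eq0; first last.
- by rewrite mulr_ge0 ?sumr_ge0 // ?ltW // => u _; apply: sqr_ge0.
- by rewrite mulr_ge0 ?sumr_ge0 ?sqr_ge0.
rewrite !mulf_eq0 ?expf_eq0 (gt_eqF nR) (gt_eqF kln_gt0) !orFb.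
rewrite !psumr_eq0 // => [|u _]; last exact: sqr_ge0.
case/andP => /allP slack0 /allP deg0.
have dE u : n%:R * d u = T.
  have := deg0 u (mem_index_enum u).
  by rewrite expf_eq0 subr_eq0 => /eqP.
have d_gt0 u : 0 < d u by rewrite -(pmulr_rgt0 _ nR) dE.
have slackE u : rayleigh_slack e l u = 0.
  have := slack0 u (mem_index_enum u).
  rewrite paddr_eq0 ?mulr_ge0 ?ler0n ?rayleigh_slack_ge0 ?turan_slack_ge0 //.
  by rewrite mulf_eq0 (gt_eqF kR) => /andP[/eqP].
have common u v : ~~ e u v ->
    n%:R * \sum_(j in [set j | e u j]) (e v j)%:R = l * d u.
  exact: cut_eigenvector_codegree (slackE u).
(* Take v = u in [common]: the common neighbours are then all of the neighbours of u. *)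
have lE : l = n%:R.
  pose u := Ordinal n_gt0.
  have euu : ~~ e u u by rewrite eirr.
  apply: (mulIf (lt0r_neq0 (d_gt0 u))); rewrite -(common u u euu) /d natr_deg.
  congr (_ * _); rewrite big_mkcond; apply: eq_bigr => j _.
  by rewrite inE; case: (e u j).
(* With l = n, non-adjacent u and v have as many common neighbours as u has neighbours. *)
have nbr_sub u v z : ~~ e u v -> e u z -> e v z.
  move=> euv euz; have /eqP := common u v euv; rewrite lE.
  rewrite (inj_eq (mulfI (lt0r_neq0 nR))) -subr_eq0 -oppr_eq0 opprB.
  have -> : d u = \sum_(j in [set j | e u j]) 1.
    by rewrite sumr_const.
  rewrite -sumrB psumr_eq0 => [|j _]; last by case: (e v j); rewrite ?subrr ?subr0 ?ler01.
  move=> /allP/(_ z (mem_index_enum z)); rewrite inE euz /=.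
  by case: (e v z); rewrite // subr0 oner_eq0.
pose u0 := Ordinal n_gt0; pose c := (n - deg e u0)%N.
have degE u : deg e u = deg e u0.
  apply/eqP; rewrite -(eqr_nat R); apply/eqP/(mulfI (lt0r_neq0 nR)).
  by rewrite (dE u) (dE u0).
have cE : c%:R = n%:R - d u0 :> R by rewrite natrB // ltnW.
apply: (@regular_complete_multipartiteI n k.+2 c) => //.
- by rewrite subn_gt0.
- apply/eqP; rewrite -(eqr_nat R) natrM cE -natr1; apply/eqP.
  (* With l = n and T = n d, the vanishing numerator reads (k+1)(n - d) = d up to the factor n^2,
     that is (k+2)c = n. *)
  move: num0; rewrite lE -(dE u0) => num0.
  apply: (mulfI (lt0r_neq0 (mulr_gt0 nR nR))); apply/eqP; rewrite -subr_eq0.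
  by apply/eqP; rewrite -[RHS]num0; ring.
- move=> x; rewrite /c -(degE x) -[X in (X - _)%N]card_ord -(cardsC [set j | e x j]).
  rewrite addKn; by apply: eq_card => y; rewrite !inE.
move=> x y z exy; apply/idP/idP; apply: nbr_sub => //.
by rewrite esym.
Qed.
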